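(* The classes of normaloid operators and of conditionally positive definite (CPD) operators are such that neither is contained in the other: there exists a bounded operator on a complex Hilbert space which is normaloid but not CPD, and there exists a bounded operator on a complex Hilbert space which is CPD but not normaloid.
   Context: A bounded linear operator $T$ on a complex Hilbert space is normaloid if $r(T)=\|T\|$, where $r(T)$ is the spectral radius of $T$. A real sequence $\{\gamma_k\}_{k=0}^{\infty}$ is conditionally positive definite (CPD) if $\sum_{i,j=0}^{k} \gamma_{i+j}\lambda_i\bar{\lambda}_j \geq 0$ for every integer $k\geq 0$ and all $\lambda_0,\dots,\lambda_k \in \mathbb{C}$ such that $\sum_{i=0}^{k}\lambda_i = 0$. A bounded operator $T$ on a complex Hilbert space $\mathcal{H}$ is CPD if, for every $h\in\mathcal{H}$, the sequence $\{\|T^k h\|^2\}_{k=0}^{\infty}$ is CPD. *)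

(* Defs.v *)
From HB Require Import structures.
From mathcomp Require Import all_boot all_order all_algebra.
From mathcomp Require Import complex.
From mathcomp Require Import boolp classical_sets reals topology normedtype.

Set Implicit Arguments.
Unset Strict Implicit.
Unset Printing Implicit Defensive.

Import Order.TTheory GRing.Theory Num.Theory.
Import numFieldNormedType.Exports.

Local Open Scope classical_set_scope.
Local Open Scope ring_scope.
Local Open Scope complex_scope.

(* [dotH] is linear in its first argument and conjugate-linear in its second. *)
HB.mixin Record CompleteNormedModule_isHilbert (R : realType) H
    & CompleteNormedModule R[i] H := {
  dotH : {dot H for (@Num.conj R[i])};
  dotHE : forall x : H, `|x| ^+ 2 = dotH x x
}.

#[short(type="hilbertType")]
HB.structure Definition Hilbert (R : realType) :=
  {H of CompleteNormedModule R[i] H & CompleteNormedModule_isHilbert R H}.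

Section BoundedOperators.
Context {R : realType} {H : hilbertType R}.
Implicit Types T S : {linear H -> H}.

(* The norm of a normed module over R[i] takes its values in R[i] (they are
   nonnegative real elements there); [normH] is the same norm, valued in R. *)
Definition normH (x : H) : R := complex.Re `|x|.

Definition bounded_operator T : Prop :=
  exists M : R, forall x : H, normH (T x) <= M * normH x.

(* This is the operator norm for bounded [T]; [sup] is 0 on unbounded sets. *)
Definition opnorm T : R := sup [set normH (T x) | x in [set x | normH x <= 1]].

(* The resolvent condition: [z - T] has an inverse among bounded operators. *)
Definition in_resolvent T (z : R[i]) : Prop :=
  exists S, [/\ bounded_operator S,
    (forall x, S (z *: x - T x) = x) & (forall x, z *: S x - T (S x) = x)].

Definition spectrum T : set R[i] := [set z | ~ in_resolvent T z].

(* The spectrum is empty only if [H] is zero; [sup] of the empty set is 0. *)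
Definition spectral_radius T : R :=
  sup [set complex.Re `|z| | z in spectrum T].

Definition normaloid T : Prop := spectral_radius T = opnorm T.

End BoundedOperators.

(* The order of R[i] is such that [0 <= z] says that [z] is real and
   nonnegative. *)
Definition cpd_seq (R : realType) (gamma : nat -> R) : Prop :=
  forall (k : nat) (lam : 'I_k.+1 -> R[i]), \sum_(i < k.+1) lam i = 0 ->
    0 <= \sum_(i < k.+1) \sum_(j < k.+1) (gamma (i + j)%N)%:C * lam i * Num.conj (lam j).

Definition cpd (R : realType) (H : hilbertType R) (T : {linear H -> H}) : Prop :=
  forall h : H, cpd_seq (fun k => normH (iter k T h) ^+ 2).

(* Main.v *)
(* Both witnesses are matrices acting on a Euclidean space C^n.  The contraction
   (x, y, z) |-> (x, 0, y) fixes a vector, hence is normaloid, while the orbit of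
   the second basis vector has squared norms 1, 1, 0, ..., whose second difference
   is negative.  For (x, y) |-> (x, x + y) the squared norms of an orbit are a
   quadratic polynomial a + b k + c k^2 with c >= 0, and on sequences lambda of sum
   0 the form with entries gamma_(i+j) reduces to 2 c |sum_i i lambda_i|^2; its
   spectrum is {1}, but the first basis vector is mapped to a vector of norm
   sqrt 2. *)
Require Import Defs.
From HB Require Import structures.
From mathcomp Require Import all_boot all_order all_algebra.
From mathcomp Require Import complex ring.
From mathcomp Require Import boolp classical_sets reals topology normedtype.

Set Implicit Arguments.
Unset Strict Implicit.
Unset Printing Implicit Defensive.

Import Order.TTheory GRing.Theory Num.Theory.
Import numFieldNormedType.Exports.

Local Open Scope classical_set_scope.
Local Open Scope ring_scope.
Local Open Scope complex_scope.

(** * Modulus of a complex number against its real and imaginary parts *)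

Lemma normc_le_ReIm (R : rcfType) (z : R[i]) :
  `|z| <= (`|complex.Re z| + `|complex.Im z|)%:C.
Proof.
rewrite [z in leLHS]complexE (le_trans (ler_normD _ _))// normrM.
have -> : `|'i%C| = 1 :> R[i] by rewrite normc_def /= expr0n expr1n add0r sqrtr1.
by rewrite mul1r !normc_def /= !expr0n !addr0 !sqrtr_sqr rmorphD.
Qed.

Lemma normc_ge_Im (R : rcfType) (z : R[i]) : `|complex.Im z|%:C <= `|z|.
Proof.
by rewrite normc_def lecR -sqrtr_sqr ler_wsqrtr // lerDr sqr_ge0.
Qed.

(* An alias of ['rV[R[i]]_n], whose own norm is the maximum norm. *)
Definition euclid (R : realType) (n : nat) := 'rV[R[i]]_n.

(** * The Hilbert space C^n with its Euclidean norm *)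

Section Euclid.
Variables (R : realType) (n : nat).
Local Notation E := (euclid R n).

HB.instance Definition _ := GRing.Lmodule.on E.

Definition euclid_norm (x : E) : R[i] := sqrtC (dotmx x x).

Let euclid_normD (x y : E) : euclid_norm (x + y) <= euclid_norm x + euclid_norm y.
Proof. exact: (triangle_lerif (@dotmx R[i] n)). Qed.

Let euclid_normZ (l : R[i]) (x : E) : euclid_norm (l *: x) = `|l| * euclid_norm x.
Proof.
rewrite /euclid_norm (dnormZ (@dotmx R[i] n)) sqrtCM ?nnegrE ?exprn_ge0//.
by rewrite sqrCK.
Qed.

Let euclid_norm_eq0 (x : E) : euclid_norm x = 0 -> x = 0.
Proof. by move=> /eqP; rewrite sqrtC_eq0 dnorm_eq0 => /eqP. Qed.

HB.instance Definition _ :=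
  Lmodule_isNormed.Build R[i] E euclid_normD euclid_normZ euclid_norm_eq0.

Lemma sqr_euclid_norm (x : E) : `|x| ^+ 2 = \sum_j `|x 0 j| ^+ 2.
Proof.
rewrite sqrtCK dotmxE mxE; apply: eq_bigr => j _.
by rewrite !mxE normCK.
Qed.

Lemma euclid_coord_le (x : E) j : `|x 0 j| <= `|x|.
Proof.
rewrite -ler_sqr ?nnegrE// sqr_euclid_norm (bigD1 j)//= lerDl.
by apply: sumr_ge0 => i _; exact: exprn_ge0.
Qed.

Lemma euclid_norm_delta j : `|delta_mx 0 j : E| = 1.
Proof.
apply/eqP; rewrite -(@eqrXn2 _ 2)//; apply/eqP.
rewrite sqr_euclid_norm (bigD1 j)//= big1 => [|i ij].
  by rewrite !mxE !eqxx normr1 expr1n addr0.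
by rewrite !mxE (negPf ij) andbF normr0 expr0n.
Qed.

Lemma euclid_le_coord (x : E) : `|x| <= \sum_j `|x 0 j|.
Proof.
rewrite [x in leLHS](row_sum_delta x) (le_trans (ler_norm_sum _ _ _))//.
by apply: ler_sum => j _; rewrite normrZ euclid_norm_delta mulr1.
Qed.

(** A 1-Lipschitz map sends a Cauchy filter to a Cauchy filter, and [R] is complete. It is meant for
    the real and imaginary parts of the coordinates. *)
Lemma euclid_cauchy_cvg_fun (F : set_system E) (f : E -> R) :
    ProperFilter F -> cauchy F ->
    (forall x y, `|f x - f y|%:C <= `|x - y|) ->
  cvg (f @ F).
Proof.
move=> FF /cauchy_ballP Fc fle; apply: cauchy_cvg; apply/cauchy_ballP => e e0.
rewrite near_map2.
have e0C : 0 < e%:C :> R[i] by rewrite ltcR.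
apply: filterS (Fc _ e0C) => -[x y] /=.
rewrite -!ball_normE /= => xy; rewrite -ltcR.
exact: le_lt_trans (fle _ _) xy.
Qed.

Lemma euclid_complete (F : set_system E) : ProperFilter F -> cauchy F -> cvg F.
Proof.
move=> FF Fc.
have cvRe j : cvg ((fun x : E => complex.Re (x 0 j)) @ F).
  apply: euclid_cauchy_cvg_fun => // x y; apply: le_trans (euclid_coord_le _ j).
  by rewrite !mxE -raddfB; exact: normc_ge_Re.
have cvIm j : cvg ((fun x : E => complex.Im (x 0 j)) @ F).
  apply: euclid_cauchy_cvg_fun => // x y; apply: le_trans (euclid_coord_le _ j).
  by rewrite !mxE -raddfB; exact: normc_ge_Im.
pose l : E := \row_j (lim ((fun x : E => complex.Re (x 0 j)) @ F) +i*
                      lim ((fun x : E => complex.Im (x 0 j)) @ F)).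
apply/cvg_ex; exists l; apply/cvgrPdist_lt => e e0.
(* A positive element of [R[i]] has imaginary part 0. *)
have [r r0 rE] : exists2 r : R, 0 < r & e = r%:C.
  by case: e e0 => a b; rewrite ltcE /= => /andP[/eqP -> a0]; exists a.
(* The distance to [l] will be bounded by [2 * n] errors below [d]; dividing by [2 * n + 1] keeps
   their sum strictly below [r], also for [n = 0]. *)
pose d := r / (n.*2.+1)%:R.
have d0 : 0 < d by rewrite divr_gt0 ?ltr0n.
near=> x.
rewrite rE (le_lt_trans (euclid_le_coord _))//.
apply: (@le_lt_trans _ _ (\sum_(j < n) (d + d)%:C)).
  apply: ler_sum => j _; rewrite (le_trans (normc_le_ReIm _))// lecR.
  rewrite !mxE !raddfB /= lerD// ltW//; move: j; near: x; apply: filter_forall => j.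
    by have /cvgrPdist_lt/(_ _ d0) := cvRe j.
  by have /cvgrPdist_lt/(_ _ d0) := cvIm j.
rewrite -rmorph_sum /= ltcR sumr_const card_ord -mulr2n -mulrnA mul2n.
by rewrite -mulr_natr /d mulrAC ltr_pdivrMr ?ltr0n// ltr_pM2l// ltr_nat.
Unshelve. all: by end_near. Qed.

HB.instance Definition _ := Uniform_isComplete.Build E euclid_complete.

Let euclid_dotE (x : E) : `|x| ^+ 2 = (@dotmx R[i] n : {dot E for Num.conj}) x x.
Proof. by rewrite sqrtCK. Qed.

HB.instance Definition _ := CompleteNormedModule_isHilbert.Build R E euclid_dotE.

End Euclid.

(** * The real-valued norm and suprema *)

Section NormH.
Variables (R : realType) (H : hilbertType R).
Implicit Types (x : H) (T : {linear H -> H}).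

Lemma normHC x : (normH x)%:C = `|x|.
Proof. by rewrite RRe_real// ger0_real. Qed.

Lemma normH_ge0 x : 0 <= normH x.
Proof. by rewrite -lecR normHC normr_ge0. Qed.

Lemma opnorm_ge T x : bounded_operator T -> normH x <= 1 -> normH (T x) <= opnorm T.
Proof.
move=> [M TM] x1; apply: ub_le_sup; last by exists x.
(* The bound [M] has no prescribed sign, so its absolute value serves as upper bound on the unit
   ball. *)
exists `|M| => _ [y /= y1 <-].
rewrite (le_trans (TM y))// (le_trans (ler_wpM2r (normH_ge0 _) (ler_norm M)))//.
by rewrite ler_piMr.
Qed.

End NormH.

Lemma sup_max_eq (R : realType) (S : set R) (m : R) : S m -> ubound S m -> sup S = m.
Proof.
move=> Sm Sub; apply/eqP; rewrite eq_le ge_sup//=; last by exists m.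
by apply: ub_le_sup => //; exists m.
Qed.

(** * Matrices as bounded operators, and their spectra *)

Section MatrixOperator.
Variables (R : realType) (n : nat).
Implicit Types (A : 'M[R[i]]_n) (x : euclid R n) (z : R[i]).

(** Vectors are rows, so row [j] of [A] is the image of basis vector [j], and [eigenvalue], which is
    about row vectors, applies directly. *)
Definition mxop A (x : euclid R n) : euclid R n := x *m A.

Let mxop_linear A : linear (mxop A).
Proof. by move=> a x y; rewrite /mxop mulmxDl scalemxAl. Qed.

HB.instance Definition _ A :=
  GRing.isLinear.Build R[i] (euclid R n) (euclid R n) _ (mxop A) (mxop_linear A).

Lemma sqr_normH_euclid x : (normH x ^+ 2)%:C = \sum_j `|x 0 j| ^+ 2.
Proof. by rewrite rmorphXn/= normHC sqr_euclid_norm. Qed.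

Lemma mxop_bounded A : bounded_operator (mxop A).
Proof.
exists (\sum_j normH (row j A : euclid R n)) => x.
rewrite -lecR rmorphM/= !normHC rmorph_sum/=.
rewrite /mxop mulmx_sum_row (le_trans (ler_norm_sum _ _ _))// mulr_suml.
apply: ler_sum => j _; rewrite normrZ normHC mulrC ler_wpM2l//.
exact: euclid_coord_le.
Qed.

(** In finite dimension an injective [A - z] is invertible, and its inverse, again a matrix, is
    bounded. *)
Lemma spectrum_mxop A : spectrum (mxop A) = [set z | eigenvalue A z].
Proof.
apply/seteqP; split => z /=; last first.
  (* A left inverse of [z - A] would send [0], the image of the eigenvector [v], back to [v]. *)
  move=> /eigenvalueP[v vA v0] [S [_ SK _]]; move/eqP: v0; apply.
  by rewrite -[LHS]SK /= /mxop vA subrr linear0.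
apply: contra_notT; rewrite negbK kermx_eq0 row_free_unit => Au.
exists (mxop (- invmx (A - z%:M))); split; first exact: mxop_bounded.
  move=> x /=; rewrite /mxop.
  by rewrite -opprB -mul_mx_scalar -mulmxBr mulNmx mulmxN opprK mulmxK.
move=> x /=; rewrite /mxop.
by rewrite -opprB -mul_mx_scalar -mulmxBr mulmxN mulNmx opprK mulmxKV.
Qed.

(** Both suprema are maxima equal to 1: eigenvalues of a contraction have modulus at most 1, and a
    fixed vector, once normalised, attains the norm. *)
Lemma contraction_normaloid A :
  (forall x, normH (mxop A x) <= normH x) -> eigenvalue A 1 -> normaloid (mxop A).
Proof.
move=> Acontr A1; rewrite /normaloid /spectral_radius spectrum_mxop.
transitivity (1 : R).
  apply: sup_max_eq; first by exists 1 => //; rewrite normr1.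
  move=> _ [z /= /eigenvalueP[v vA v0] <-].
  have := Acontr v; rewrite /mxop vA -lecR !normHC normrZ.
  rewrite ger_pMl ?normr_gt0// => z1.
  by rewrite -lecR.
apply: esym; apply: sup_max_eq; last first.
  by move=> _ [x /= x1 <-]; exact: le_trans (Acontr _) x1.
have /eigenvalueP[v vA v0] := A1; rewrite scale1r in vA.
pose w : euclid R n := `|v : euclid R n|^-1 *: (v : euclid R n).
have w1 : normH w = 1.
  apply: complexI; rewrite normHC normrZ normfV normr_id mulVf//.
  by rewrite normr_eq0.
exists w; first by rewrite /= w1.
have Tv : mxop A v = v by [].
by rewrite linearZ /= Tv.
Qed.

End MatrixOperator.

(** Expanding the square gives [g (i + j) = p i + q j + 2 c i j]. Terms depending on one index only
    vanish against [lam] of sum 0, which leaves [2 c] times the squared modulus of [s]. *)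
Lemma cpd_seq_quadratic (R : realType) (g : nat -> R) (a b c : R) :
  0 <= c -> (forall k, g k = a + b * k%:R + c * k%:R ^+ 2) -> cpd_seq g.
Proof.
move=> c0 gE k lam lam0.
(* The constant [a] must be counted once, so [p] carries it and [q] does not. *)
pose p (i : nat) : R[i] := (a + b * i%:R + c * i%:R ^+ 2)%:C.
pose q (i : nat) : R[i] := (b * i%:R + c * i%:R ^+ 2)%:C.
pose s := \sum_(i < k.+1) i%:R * lam i.
have -> : \sum_(i < k.+1) \sum_(j < k.+1) (g (i + j)%N)%:C * lam i * (lam j)^* =
    (c *+ 2)%:C * (s * s^*).
  have conj0 : \sum_(i < k.+1) (lam i)^* = 0 by rewrite -rmorph_sum lam0 rmorph0.
  under eq_bigr => i _.
    rewrite (_ : \sum__ _ = p i * lam i * (\sum_(j < k.+1) (lam j)^*) +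
      lam i * (\sum_(j < k.+1) q j * (lam j)^*) +
      (c *+ 2)%:C * (i%:R * lam i * \sum_(j < k.+1) j%:R * (lam j)^*)); last first.
      rewrite !mulr_sumr -!big_split/=; apply: eq_bigr => j _.
      have -> : (g (i + j)%N)%:C = p i + q j + (c *+ 2)%:C * i%:R * j%:R.
        rewrite gE -2!(rmorph_nat (@real_complex R)) -!rmorphM -!rmorphD/=.
        by congr _%:C; rewrite natrD; ring.
      by ring.
    rewrite conj0 mulr0 add0r; over.
  rewrite big_split/= -mulr_suml lam0 mul0r add0r -mulr_sumr -mulr_suml.
  congr (_ * (_ * _)); rewrite rmorph_sum; apply: eq_bigr => j _.
  by rewrite rmorphM/= rmorph_nat.
by rewrite mulr_ge0 ?mul_conjC_ge0// ler0c mulrn_wge0.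
Qed.

(** * The two witnesses *)

Section Examples.
Variable R : realType.
Local Notation C := R[i].

(** Direct sum of the identity on C, which makes the operator normaloid, and a nilpotent shift on
    C^2, which breaks CPD. *)
Definition one_plus_nilpotent : 'M[C]_3 := delta_mx 0 0 + delta_mx 1 2%:R.

Lemma one_plus_nilpotentE (x : euclid R 3) :
  mxop one_plus_nilpotent x = x 0 0 *: delta_mx 0 0 + x 0 1 *: delta_mx 0 2%:R.
Proof.
apply/rowP => j; rewrite /mxop mulmxDr !mxE !big_ord_recl !big_ord0 !mxE/=.
case: j => -[|[|[|//]]] ? /=; rewrite !(mulr1, mulr0, addr0, add0r)//.
all: by congr (x _ _); apply/val_inj.
Qed.

Lemma one_plus_nilpotent_normaloid : normaloid (mxop one_plus_nilpotent).
Proof.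
apply: contraction_normaloid => [x|]; last first.
  apply/eigenvalueP; exists (delta_mx 0 0).
    by rewrite mulmxDr !mul_delta_mx_cond/= mulr1n mulr0n addr0 scale1r.
  by apply/eqP => /rowP/(_ 0)/eqP; rewrite !mxE/= oner_eq0.
rewrite -ler_sqr ?nnegrE ?normH_ge0// -lecR !sqr_normH_euclid.
rewrite one_plus_nilpotentE !big_ord_recl !big_ord0 !mxE/=.
rewrite !(mulr1, mulr0, addr0, add0r) normr0 expr0n/= add0r.
rewrite lerD2l [X in x _ X](_ : _ = lift ord0 ord0); last exact/val_inj.
by rewrite lerDl exprn_ge0.
Qed.

Lemma one_plus_nilpotent_not_cpd : ~ cpd (mxop one_plus_nilpotent).
Proof.
pose e (j : 'I_3) : euclid R 3 := delta_mx 0 j.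
have T1 : mxop one_plus_nilpotent (e 1) = e 2%:R.
  by rewrite one_plus_nilpotentE !mxE/= scale0r add0r scale1r.
have T2 : mxop one_plus_nilpotent (e 2%:R) = 0.
  by rewrite one_plus_nilpotentE !mxE/= !scale0r addr0.
have ne j : normH (e j) = 1 by apply: complexI; rewrite normHC euclid_norm_delta.
have n0 : normH (0 : euclid R 3) = 0 by rewrite /normH normr0.
(* With weights [1, -1] the form is the second difference [1 - 2 * 1 + 0 = -1]. *)
move=> /(_ (e 1) 1%N (fun i => if i == 0 then 1 else -1)).
rewrite !big_ord_recl !big_ord0/= !addr0 subrr => /(_ erefl).
rewrite T1 T2 !ne n0 expr1n expr0n/= rmorphN !rmorph1 rmorph0.
rewrite !(mulr1, mul0r, mulrN, oppr0, addr0) subrr add0r.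
by rewrite oppr_ge0 ler10.
Qed.

Definition jordan_block : 'M[C]_2 := 1%:M + delta_mx 0 1.

Lemma jordan_blockE (x : euclid R 2) :
  mxop jordan_block x = x + x 0 0 *: delta_mx 0 1.
Proof.
rewrite /mxop mulmxDr mulmx1; congr (_ + _).
apply/rowP => j; rewrite !mxE !big_ord_recl !big_ord0 !mxE/=.
by rewrite mulr0 !addr0.
Qed.

(** The nilpotent part squares to 0, so the [k]-th power of the block is the identity plus [k] times
    that part. *)
Lemma iter_jordan_block k (x : euclid R 2) :
  iter k (mxop jordan_block) x = x + (x 0 0 *+ k) *: delta_mx 0 1.
Proof.
elim: k => [|k IH]; first by rewrite mulr0n scale0r addr0.
rewrite iterS IH jordan_blockE !mxE/= mulr0 addr0 -addrA -scalerDl.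
by rewrite mulrSr.
Qed.

Lemma jordan_block_cpd : cpd (mxop jordan_block).
Proof.
move=> h; pose x := h 0 0; pose y := h 0 1.
pose N (z : C) := complex.Re z ^+ 2 + complex.Im z ^+ 2.
(* Coefficients in [k] of [|x|^2 + |y + k x|^2]; the middle one is twice the real part of [x] times
   the conjugate of [y]. *)
apply: (@cpd_seq_quadratic _ _ (N x + N y)
  ((complex.Re x * complex.Re y + complex.Im x * complex.Im y) *+ 2) (N x)).
  by rewrite addr_ge0 ?sqr_ge0.
move=> k; apply: complexI; rewrite sqr_normH_euclid iter_jordan_block.
rewrite !big_ord_recl !big_ord0 !mxE/= mulr0 mulr1 !addr0.
rewrite (_ : lift ord0 ord0 = 1); last exact/val_inj.
have NC z : `|z| ^+ 2 = (N z)%:C by rewrite -add_Re2_Im2.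
rewrite -/x -/y !NC -(rmorphD (real_complex R)); congr (real_complex _ _).
rewrite /N.
have -> : complex.Re (y + x *+ k) = complex.Re y + complex.Re x *+ k.
  by rewrite raddfD raddfMn.
have -> : complex.Im (y + x *+ k) = complex.Im y + complex.Im x *+ k.
  by rewrite raddfD raddfMn.
move: (complex.Re x) (complex.Re y) (complex.Im x) (complex.Im y) => xr yr xi yi; ring.
Qed.

Lemma jordan_block_not_normaloid : ~ normaloid (mxop jordan_block).
Proof.
rewrite /normaloid /spectral_radius spectrum_mxop => rE.
have sr1 : sup [set complex.Re `|z| | z in [set z | eigenvalue jordan_block z]] = 1.
  apply: sup_max_eq => [|_ [z /eigenvalueP[v vA v0] <-]].
    exists 1; last by rewrite normr1.
    apply/eigenvalueP; exists (delta_mx 0 1).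
      by rewrite mulmxDr mulmx1 mul_delta_mx_cond/= mulr0n addr0 scale1r.
    by apply/eqP => /rowP/(_ 1)/eqP; rewrite !mxE/= oner_eq0.
  suff -> : z = 1 by rewrite normr1.
  (* The coordinates read [z v_0 = v_0] and [z v_1 = v_1 + v_0]; if [z] differs from 1, the first
     kills [v_0], then the second kills [v_1]. *)
  have /rowP vE := (jordan_blockE v : v *m _ = _).
  have := vE 0; have := vE 1.
  rewrite vA !mxE/= mulr1 mulr0 addr0 => z1 z0.
  apply/eqP; apply: contraNT v0; rewrite -subr_eq0 => z_neq1.
  have v00 : v 0 0 = 0.
    by apply: (mulfI z_neq1); rewrite mulr0 mulrBl z0 mul1r subrr.
  have v01 : v 0 1 = 0.
    by apply: (mulfI z_neq1); rewrite mulr0 mulrBl z1 v00 addr0 mul1r subrr.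
  apply/eqP/rowP => j; rewrite mxE; case: j => -[|[|//]] jlt.
    by rewrite -[RHS]v00; congr (v _ _); exact/val_inj.
  by rewrite -[RHS]v01; congr (v _ _); exact/val_inj.
(* If the norm were 1, the image [(1, 1)] of the first basis vector would give [1 + 1 <= 1] after
   squaring. *)
have /= := @opnorm_ge _ _ (mxop jordan_block) (delta_mx 0 0 : euclid R 2) (mxop_bounded _).
have -> : normH (delta_mx 0 0 : euclid R 2) = 1.
  by apply: complexI; rewrite normHC euclid_norm_delta.
move=> /(_ (lexx _)); rewrite -rE sr1.
rewrite -(@ler_pXn2r _ 2)// ?nnegrE ?normH_ge0// -lecR sqr_normH_euclid.
rewrite jordan_blockE !big_ord_recl !big_ord0 !mxE/=.
rewrite !(mulr1, mulr0, addr0, add0r) normr1 !expr1n.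
by rewrite gerDl ler10.
Qed.

End Examples.

Theorem mainTheorem2 (R : realType) :
  (exists (H : hilbertType R) (T : {linear H -> H}),
     [/\ bounded_operator T, normaloid T & ~ cpd T]) /\
  (exists (H : hilbertType R) (T : {linear H -> H}),
     [/\ bounded_operator T, cpd T & ~ normaloid T]).
Proof.
split; [exists (euclid R 3), (mxop (one_plus_nilpotent R))
       | exists (euclid R 2), (mxop (jordan_block R))].
  split; [exact: mxop_bounded | exact: one_plus_nilpotent_normaloid |
    exact: one_plus_nilpotent_not_cpd].
split; [exact: mxop_bounded | exact: jordan_block_cpd |
  exact: jordan_block_not_normaloid].
Qed.
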